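(* Let $n\ge 1$, let $\Omega$ be a finite subset of $\mathbb{Z}^n$, let $V:\Omega\to[0,\infty)$ be a nonnegative potential and $\rho:\Omega\to(0,\infty)$ a positive density, and let $0<\lambda_1\le\lambda_2\le\cdots\le\lambda_{\sharp\Omega}$ be the eigenvalues, counted with multiplicity, of the weighted Dirichlet Schrödinger problem $$-\Delta u+Vu=\lambda\rho u \ \text{ in } \Omega,\qquad u=0\ \text{ on } \partial\Omega .$$ Put $\rho_{\min}=\min_{\Omega}\rho$ and $\rho_{\max}=\max_{\Omega}\rho$. Then for every integer $k$ with $1\le k\le \sharp\Omega-1$, $$\sum_{i=1}^{k}(\lambda_{k+1}-\lambda_i)\left(\lambda_{k+1}\left(\frac{\rho_{\min}}{\rho_{\max}}-\rho_{\min}\lambda_i\right)-\lambda_i\left(\frac{\rho_{\min}}{\rho_{\max}}-\rho_{\min}\lambda_i+\frac{4}{n}\right)\right)\le 0 .$$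
   Context: $\mathbb{Z}^n$ is the integer lattice graph: $x\sim y$ if and only if $\sum_{i=1}^n|x_i-y_i|=1$; every vertex has degree $d_x=2n$. The discrete (normalized) Laplacian is $\Delta f(x)=\frac{1}{d_x}\sum_{y\sim x}(f(y)-f(x))$. The vertex boundary is $\partial\Omega=\{y\in\mathbb{Z}^n\setminus\Omega: y\sim x\text{ for some }x\in\Omega\}$. Functions on $\Omega$ are extended by zero to $\mathbb{Z}^n$, so the eigenvalue problem asks for nonzero $u:\Omega\to\mathbb{R}$, extended by zero, with $-\Delta u(x)+V(x)u(x)=\lambda\rho(x)u(x)$ for all $x\in\Omega$. The operator $(-\Delta+V)/\rho$ with this Dirichlet condition is self-adjoint on $\ell^2(\Omega,\rho)$, with inner product $\langle f,g\rangle=\sum_{x\in\Omega}f(x)g(x)\rho(x)d_x$, and has $\sharp\Omega$ real positive eigenvalues counted with multiplicity. $\sharp\Omega$ denotes the cardinality of $\Omega$. *)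

(* Defs.v *)
From HB Require Import structures.
From mathcomp Require Import all_boot all_order all_algebra.
From mathcomp Require Import finmap.
From mathcomp Require Import boolp classical_sets functions cardinality fsbigop.
From mathcomp Require Import reals.

Set Implicit Arguments.
Unset Strict Implicit.
Unset Printing Implicit Defensive.

Import Order.TTheory GRing.Theory Num.Theory.
Local Open Scope classical_set_scope.
Local Open Scope ring_scope.

Definition adj (n : nat) (x y : 'rV[int]_n) : bool :=
  \sum_(i < n) `|x 0 i - y 0 i| == 1.

Definition nbhd (n : nat) (x : 'rV[int]_n) : set 'rV[int]_n :=
  [set y | adj x y].

Definition step (n : nat) (p : 'I_n * bool) : 'rV[int]_n :=
  (-1) ^+ p.2 *: delta_mx 0 p.1.

Lemma step_inj (n : nat) : injective (@step n).
Proof.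
move=> [i b] [j c] /= /rowP e.
have := e i; rewrite !mxE !eqxx /=.
case: (eqVneq i j) => [->|_].
  by case: b {e}; case: c; rewrite ?expr0 ?expr1 => // /eqP.
by rewrite mulr0; case: b {e} => /eqP.
Qed.

Lemma adj_stepP (n : nat) (x y : 'rV[int]_n) :
  reflect (exists p, y = x + step p) (adj x y).
Proof.
apply: (iffP eqP) => [sum1|[[i b] ->]]; last first.
  rewrite (bigD1 i) //= big1 => [|j ji]; rewrite !mxE eqxx /=.
    by rewrite opprD addNKr eqxx addr0 mulr1 normrN normr_sign.
  by rewrite (negPf ji) mulr0 addr0 subrr normr0.
have [i xyi] : exists i, x 0 i - y 0 i != 0.
  apply/existsP; apply: contraPT sum1 => /existsPn xy0.
  by rewrite big1 // => i _; move: (xy0 i); rewrite negbK => /eqP ->.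
move: sum1; rewrite (bigD1 i) //=.
set s := \sum_(_ < _ | _) _ => sum1.
have s_ge0 : 0 <= s by apply: sumr_ge0.
have d_ge1 : 1 <= `|x 0 i - y 0 i| by rewrite -gtz0_ge1 normr_gt0.
have s0 : s = 0.
  by apply/le_anti; rewrite s_ge0 andbT -(lerD2l `|x 0 i - y 0 i|) sum1 addr0.
have d1 : `|x 0 i - y 0 i| = 1 by rewrite -sum1 s0 addr0.
exists (i, 0 < x 0 i - y 0 i); apply/rowP => j; rewrite !mxE eqxx /=.
have [->|ji] := eqVneq j i; last first.
  rewrite mulr0 addr0; apply/esym/eqP; rewrite -subr_eq0 -normr_eq0.
  by move/eqP: s0; rewrite psumr_eq0 // => /allP/(_ j (mem_index_enum j)) /=;
    rewrite ji.
rewrite mulr1 -[LHS](subKr (x 0 i)); congr (_ + _).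
case: ltP => [d_gt0|d_le0].
  by rewrite -(gtr0_norm d_gt0) d1 expr1.
by rewrite expr0 -(ler0_norm d_le0).
Qed.

Lemma nbhdE (n : nat) (x : 'rV[int]_n) :
  nbhd x = [set` [seq x + step p | p : 'I_n * bool]].
Proof.
apply/seteqP; split=> y /=.
  by move/adj_stepP => [p ->]; apply/fintype.imageP; exists p.
by move/fintype.imageP => [p _ ->]; apply/adj_stepP; exists p.
Qed.

Lemma card_nbhd (n : nat) (x : 'rV[int]_n) : (nbhd x #= `I_(2 * n))%card.
Proof.
have -> : nbhd x = [set` [fset (x + step p)%R | p in {: 'I_n * bool}]%fset].
  rewrite nbhdE; apply/seteqP; split=> y /=.
    by move/fintype.imageP => [p _ ->]; apply/imfsetP; exists p.
  by move/imfsetP => [p _ ->]; apply/fintype.imageP; exists p.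
apply/card_eq_fsetP; rewrite card_imfset; last first.
  by move=> p q /addrI /step_inj.
by rewrite -cardE card_prod card_ord card_bool mulnC.
Qed.

(** The constant 2n is the degree of [x], by [card_nbhd], which also makes the
    finitely supported sum over [nbhd x] a genuine one. *)
Definition laplacian (R : realType) (n : nat) (f : 'rV[int]_n -> R)
    (x : 'rV[int]_n) : R :=
  (2 * n)%:R^-1 * \sum_(y \in nbhd x) (f y - f x).

Lemma laplacianE (R : realType) (n : nat) (f : 'rV[int]_n -> R)
    (x : 'rV[int]_n) :
  laplacian f x = (2 * n)%:R^-1 * \sum_p (f (x + step p) - f x).
Proof.
rewrite /laplacian nbhdE -fsbig_seq; last first.
  by rewrite map_inj_uniq ?enum_uniq // => p q /addrI /step_inj.
by rewrite big_map big_enum.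
Qed.

Section Dirichlet.
Context {R : realType} {n : nat} (Omega : {fset 'rV[int]_n}).

(** Extension by zero outside [Omega]; it encodes the condition u = 0 on the
    vertex boundary, the only points outside [Omega] the Laplacian sees. *)
Definition zero_ext (u : Omega -> R) (x : 'rV[int]_n) : R :=
  oapp u 0 (insub x).

Variables V rho : Omega -> R.

(** The operator (- Delta + V) / rho with the Dirichlet condition.  The
    codomain is written [R^o] to give the functions on [Omega] their structure
    of vector space over [R]. *)
Definition schrodinger (u : {ffun Omega -> R^o}) : {ffun Omega -> R^o} :=
  [ffun x => (- laplacian (zero_ext u) (val x) + V x * u x) / rho x].

Lemma schrodinger_is_linear : linear schrodinger.
Proof.
move=> a u v; apply/ffunP => x; rewrite !ffunE /=.
have extE y : zero_ext (a *: u + v) y = a * zero_ext u y + zero_ext v y.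
  rewrite /zero_ext; case: insub => [z|] /=; first by rewrite !ffunE.
  by rewrite mulr0 addr0.
have lapE : laplacian (zero_ext (a *: u + v)) (val x) =
    a * laplacian (zero_ext u) (val x) + laplacian (zero_ext v) (val x).
  rewrite !laplacianE mulrCA -mulrDr; congr (_ * _).
  rewrite mulr_sumr -big_split; apply: eq_bigr => p _ /=.
  by rewrite !extE mulrBr opprD addrACA.
rewrite lapE -[a *: (_ / _)]/(a * (_ / _)) -[a *: u x]/(a * u x).
rewrite [a * (_ / _)]mulrA -mulrDl; congr (_ / _).
by rewrite [in RHS]mulrDr mulrN opprD [in LHS]mulrDr [V x * (a * _)]mulrCA addrACA.
Qed.

HB.instance Definition _ :=
  GRing.isLinear.Build R {ffun Omega -> R^o} {ffun Omega -> R^o} _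
    schrodinger schrodinger_is_linear.

Definition eigenspace_of (lam : R) : {vspace {ffun Omega -> R^o}} :=
  passmx.leigenspace (linfun schrodinger) lam.

Lemma mem_eigenspaceP (lam : R) (u : {ffun Omega -> R^o}) :
  (forall x, 0 < rho x) ->
  u \in eigenspace_of lam <->
  forall x, - laplacian (zero_ext u) (val x) + V x * u x = lam * rho x * u x.
Proof.
move=> rho_gt0; rewrite /eigenspace_of /passmx.leigenspace memv_ker.
rewrite lfunE /= opp_lfunE scale_lfunE id_lfunE lfunE /= subr_eq0.
split=> [/eqP/ffunP e x|e].
  have /(congr1 ( *%R^~ (rho x))) := e x.
  by rewrite !ffunE divfK ?gt_eqF // => ->; rewrite mulrAC.
by apply/eqP/ffunP => x; rewrite !ffunE e mulrAC mulfK ?gt_eqF.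
Qed.

(** Since the length of [lam] is the cardinality of [Omega], such a list exists
    (and is then unique) because the operator is self-adjoint on
    l^2(Omega, rho) when [rho] is positive. *)
Definition eigenvalues (lam : #|` Omega|.-tuple R) : Prop :=
  sorted <=%R lam /\
  forall mu : R, count_mem mu lam = \dim (eigenspace_of mu).

End Dirichlet.

Definition is_min (R : realType) (T : Type) (f : T -> R) (m : R) : Prop :=
  (exists x, f x = m) /\ forall x, m <= f x.

Definition is_max (R : realType) (T : Type) (f : T -> R) (m : R) : Prop :=
  (exists x, f x = m) /\ forall x, f x <= m.

(* Main.v *)
Require Import Defs.
From HB Require Import structures.
From mathcomp Require Import all_boot all_order all_algebra.
From mathcomp Require Import finmap reals.
From mathcomp Require Import ring lra.

Import Order.TTheory GRing.Theory Num.Theory.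
Local Open Scope ring_scope.

(** Let L be a symmetric operator with an orthonormal eigenbasis u_0, u_1, ...
    and eigenvalues lam_0 <= lam_1 <= ..., let G be symmetric, and write
    C = LG - GL.  The part phi of G u_i orthogonal to u_0, ..., u_(k-1) is a
    test function for lam_k, and its excess energy is a pairing with C u_i:
      (lam_k - lam_i) <phi, phi> <= <L phi, phi> - lam_i <phi, phi>
                                  = <C u_i, phi>.
    Replacing C u_i here by its own part psi orthogonal to u_0, ..., u_(k-1)
    and expanding |psi - (lam_k - lam_i) phi|^2 >= 0 bounds
    (lam_k - lam_i) <psi, phi> by |psi|^2.  Both sides still contain the matrix
    elements of G among u_0, ..., u_(k-1), but after multiplication by
    lam_k - lam_i and summation over i these form an antisymmetric double sum
    and disappear.  What is left is [commutator_inequality]: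
      sum_(i < k) (lam_k - lam_i)^2 <C u_i, G u_i>
        <= sum_(i < k) (lam_k - lam_i) |C u_i|^2.

    For the operator (- Delta + V) / rho on the functions of a finite subset of
    Z^n, take for G the multiplication by each of the n coordinates and add up.
    The commutator is then a central difference quotient ([commutatorE]).
    For an eigenfunction u = u_i of norm 1, summation by parts turns the sum
    over the coordinates of <C u, G u> into the sum of u(x) u(y) over the edges,
    divided by the degree 2n.  This is half of the difference between the sum of
    (1 + V) u^2 and the energy lam_i, whence the lower bound
    (1 / rho_max - lam_i) / 2 of [commutator_form_ge].  The squared norms of
    the C u add up to at most the Dirichlet energy, times a constant, whence
    the upper bound 2 lam_i / (n rho_min) of [commutator_norm_le].  These two
    bounds and the commutator inequality give the theorem.

    That the tuple of eigenvalues comes from an orthonormal eigenbasis follows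
    from the symmetry of the operator and from the equality of the length of
    the tuple with the dimension, without a spectral theorem: the eigenvectors
    are chosen one after the other ([orthonormal_eigenvectors]). *)

(** * Orthonormal families and the commutator inequality *)

Lemma sum_antisym (R : realFieldType) (k : nat) (s : 'I_k -> 'I_k -> R) :
  (forall i j, s j i = - s i j) -> \sum_i \sum_j s i j = 0.
Proof.
move=> anti; set S := \sum_i _; suff : S = - S by lra.
rewrite {1}/S exchange_big /= /S -sumrN; apply: eq_bigr => i _.
by rewrite -sumrN; apply: eq_bigr => j _.
Qed.

Section InnerProduct.

Context {R : rcfType} {E : vectType R} (ip : E -> E -> R).

Definition inner_product : Prop :=
  [/\ forall a u v w, ip (a *: u + v) w = a * ip u w + ip v w,
      forall u v, ip u v = ip v u
    & forall u, u != 0 -> 0 < ip u u].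

Definition symmetric_op (f : E -> E) : Prop :=
  forall u v, ip (f u) v = ip u (f v).

Definition orthonormal (N : nat) (u : nat -> E) : Prop :=
  forall i j, (i < N)%N -> (j < N)%N -> ip (u i) (u j) = (i == j)%:R.

(** For an orthonormal [u], the component of [v] orthogonal to the span of
    [u 0], ..., [u k.-1]. *)
Definition residual (u : nat -> E) (k : nat) (v : E) : E :=
  v - \sum_(j < k) ip v (u j) *: u j.

Hypothesis ipP : inner_product.

Lemma ip_sym u v : ip u v = ip v u.
Proof. by case: ipP. Qed.

Lemma ipDl u v w : ip (u + v) w = ip u w + ip v w.
Proof. by case: ipP => lin _ _; rewrite -[u in LHS]scale1r lin mul1r. Qed.

Lemma ip0l w : ip 0 w = 0.
Proof. by apply: (addrI (ip 0 w)); rewrite -ipDl !addr0. Qed.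

Lemma ipZl a u w : ip (a *: u) w = a * ip u w.
Proof. by case: ipP => lin _ _; rewrite -[a *: u]addr0 lin ip0l addr0. Qed.

Lemma ipBl u v w : ip (u - v) w = ip u w - ip v w.
Proof. by rewrite ipDl -scaleN1r ipZl mulN1r. Qed.

Lemma ip_suml (I : finType) (F : I -> E) w :
  ip (\sum_i F i) w = \sum_i ip (F i) w.
Proof. exact: (big_morph (ip^~ w) (fun u v => ipDl u v w) (ip0l w)). Qed.

Lemma ipBr u v w : ip w (u - v) = ip w u - ip w v.
Proof. by rewrite ip_sym ipBl !(ip_sym w). Qed.

Lemma ipZr a u w : ip w (a *: u) = a * ip w u.
Proof. by rewrite ip_sym ipZl ip_sym. Qed.

Lemma ip_sumr (I : finType) (F : I -> E) w :
  ip w (\sum_i F i) = \sum_i ip w (F i).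
Proof. by rewrite ip_sym ip_suml; apply: eq_bigr => i _; rewrite ip_sym. Qed.

Lemma ip_ge0 u : 0 <= ip u u.
Proof.
have [->|u0] := eqVneq u 0; first by rewrite ip0l.
by case: ipP => _ _ /(_ u u0)/ltW.
Qed.

Lemma ip_eq0 u : ip u u = 0 -> u = 0.
Proof.
case: ipP => _ _ pos uu; apply/eqP; apply: contraT => /pos.
by rewrite uu ltxx.
Qed.

Lemma orthonormalW {N k : nat} {u : nat -> E} :
  (k <= N)%N -> orthonormal N u -> orthonormal k u.
Proof. by move=> kN on i j ik jk; apply: on; apply: leq_trans kN. Qed.

Lemma residual_orth {k : nat} {u : nat -> E} : orthonormal k u ->
  forall v j, (j < k)%N -> ip (residual u k v) (u j) = 0.
Proof.
move=> on v j jk; rewrite ipBl ip_suml (bigD1 (Ordinal jk)) //= big1.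
  by rewrite addr0 ipZl on // eqxx mulr1 subrr.
move=> i ij; rewrite ipZl on // (_ : _ == _ = false) ?mulr0 //.
by apply: contraNF ij => /eqP ij; apply/eqP/val_inj.
Qed.

Lemma ip_orth_residual {u : nat -> E} {k : nat} {w v : E} :
  (forall j, (j < k)%N -> ip w (u j) = 0) -> ip w (residual u k v) = ip w v.
Proof.
move=> wu; rewrite ipBr ip_sumr big1 ?subr0 // => j _.
by rewrite ipZr wu ?mulr0.
Qed.

Lemma ip_residual {k : nat} {u : nat -> E} : orthonormal k u ->
  forall v w, ip (residual u k v) (residual u k w) =
    ip v w - \sum_(j < k) ip v (u j) * ip w (u j).
Proof.
move=> on v w; rewrite (ip_orth_residual (residual_orth on v)) ipBl ip_suml.
by congr (_ - _); apply: eq_bigr => j _; rewrite ipZl (ip_sym w).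
Qed.

(** An orthonormal family is free, so [\dim {:E}] of its vectors span [E]. *)
Lemma residual_full {N : nat} {u : nat -> E} : orthonormal N u ->
  N = \dim {:E} -> forall v, residual u N v = 0.
Proof.
move=> on dimE v; apply: ip_eq0.
pose X := [tuple u i | i < N].
have Xi (i : 'I_N) : X`_i = u i by rewrite -tnth_nth tnth_mktuple.
have freeX : free X.
  apply/freeP => c c0 i.
  have := congr1 (ip^~ (u i)) c0; rewrite ip0l ip_suml (bigD1 i) //= big1.
    by rewrite addr0 Xi ipZl on // eqxx mulr1.
  move=> j ji; rewrite Xi ipZl on // (_ : _ == _ = false) ?mulr0 //.
  by apply: contraNF ji => /eqP ji; apply/eqP/val_inj.
have /coord_span -> : v \in <<X>>%VS.
  suff /eqP -> : <<X>>%VS == fullv by rewrite memvf.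
  by rewrite eqEdim subvf -dimE (eqP freeX) size_tuple /=.
set w := \sum_(_ < _) _.
rewrite (ip_orth_residual (residual_orth on w)) {2}/w ip_sumr big1 // => i _.
by rewrite Xi ipZr (residual_orth on) ?mulr0.
Qed.

Lemma mem_leigenspace (L : {linear E -> E}) (mu : R) (v : E) :
  (v \in passmx.leigenspace (linfun L) mu) = (L v == mu *: v).
Proof.
rewrite /passmx.leigenspace memv_ker.
by rewrite lfunE /= opp_lfunE scale_lfunE id_lfunE lfunE /= subr_eq0.
Qed.

(** The eigenvectors are chosen one at a time.  When the value [mu] is appended
    to [lam], the vectors already chosen for [mu] are fewer than the dimension
    of its eigenspace, so that some eigenvector lies outside their span; its
    residual is nonzero, and is still an eigenvector because eigenvectors for
    different eigenvalues are orthogonal. *)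
Lemma orthonormal_eigenvectors (L : {linear E -> E}) (lam : seq R) :
  symmetric_op L ->
  (forall mu, (count_mem mu lam <= \dim (passmx.leigenspace (linfun L) mu))%N) ->
  exists2 u : nat -> E, orthonormal (size lam) u &
    forall i, (i < size lam)%N -> L (u i) = lam`_i *: u i.
Proof.
move=> Lsym; elim/last_ind: lam => [|lam mu IH] mult; first by exists (fun=> 0).
have [u on eig] : exists2 u : nat -> E, orthonormal (size lam) u &
    forall i, (i < size lam)%N -> L (u i) = lam`_i *: u i.
  apply: IH => nu; apply: leq_trans (mult nu).
  by rewrite -cats1 count_cat leq_addr.
set N := size lam in on eig *.
set X := [seq u i | i <- iota 0 N & lam`_i == mu].
have /subvPn[v vE vX] : ~~ (passmx.leigenspace (linfun L) mu <= <<X>>)%VS.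
  apply: contraTN (mult mu) => /dimvS; rewrite -ltnNge => le.
  apply: leq_ltn_trans le _; apply: leq_ltn_trans (dim_span X) _.
  rewrite size_map size_filter -cats1 count_cat /= eqxx !addn1 ltnS.
  by rewrite -{2}[lam](mkseq_nth 0) /mkseq count_map.
move: vE; rewrite mem_leigenspace => /eqP Lv.
have orth j : (j < N)%N -> lam`_j != mu -> ip v (u j) = 0.
  move=> jN ne; have := Lsym v (u j); rewrite Lv eig // ipZl ipZr => /eqP.
  by rewrite -subr_eq0 -mulrBl mulf_eq0 subr_eq0 eq_sym (negPf ne) => /eqP.
pose r := residual u N v.
have Lr : L r = mu *: r.
  rewrite /r /residual linearB linear_sum scalerBr Lv scaler_sumr /=.
  congr (_ - _); apply: eq_bigr => j _; rewrite linearZ /= eig //.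
  have [->|ne] := eqVneq lam`_j mu; first by rewrite scalerA mulrC -scalerA.
  by rewrite orth // !scale0r scaler0.
have r0 : r != 0.
  apply: contra vX; rewrite subr_eq0 => /eqP ->; apply: memv_suml => j _.
  have [e|ne] := eqVneq lam`_j mu; last by rewrite orth // scale0r mem0v.
  apply/memvZ/memv_span/map_f; rewrite mem_filter e eqxx mem_iota /=.
  exact: ltn_ord.
have rr : 0 < ip r r by case: ipP => _ _; apply.
pose w := (Num.sqrt (ip r r))^-1 *: r.
have wu j : (j < N)%N -> ip w (u j) = 0.
  by move=> jN; rewrite /w ipZl /r (residual_orth on) ?mulr0.
have ww : ip w w = 1.
  rewrite ipZl ipZr mulrA -invfM -expr2 sqr_sqrtr ?ip_ge0 //.
  by rewrite mulVf ?gt_eqF.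
exists (fun i => if (i < N)%N then u i else w) => [i j|i];
  rewrite size_rcons -/N !ltnS.
  case: (ltngtP i N) => [iN _|//|-> _]; case: (ltngtP j N) => [jN _|//|jN _].
  - exact: on.
  - by rewrite ip_sym wu // jN ltn_eqF.
  - by rewrite wu.
  - by rewrite ww.
rewrite nth_rcons -/N; case: (ltngtP i N) => [iN _|//|_ _]; first exact: eig.
by rewrite linearZ /= Lr !scalerA mulrC.
Qed.

(** In the eigenbasis, the energy of [v] is the sum of [lam j] times the squares
    of the coordinates, which vanish below [k]. *)
Lemma rayleigh_ge (N k : nat) (u : nat -> E) (lam : nat -> R)
    (L : {linear E -> E}) (v : E) :
  symmetric_op L -> orthonormal N u -> N = \dim {:E} ->
  (forall i, (i < N)%N -> L (u i) = lam i *: u i) ->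
  (forall i, (k <= i < N)%N -> lam k <= lam i) ->
  (forall j, (j < k)%N -> ip v (u j) = 0) ->
  lam k * ip v v <= ip (L v) v.
Proof.
move=> Lsym on dimE eig lam_ge vu.
have expand w : ip w v = \sum_(j < N) ip v (u j) * ip w (u j).
  have /eqP := residual_full on dimE v; rewrite subr_eq0 => /eqP {1}->.
  by rewrite ip_sumr; apply: eq_bigr => j _; rewrite ipZr.
rewrite !expand mulr_sumr; apply: ler_sum => j _.
rewrite Lsym eig // ipZr mulrA mulrCA -!mulrA; have [jk|kj] := ltnP j k.
  by rewrite vu // !mul0r !mulr0.
by apply: ler_wpM2r; rewrite ?lam_ge ?kj ?ltn_ord // -expr2 sqr_ge0.
Qed.

Definition commutator (L G : E -> E) (v : E) : E := L (G v) - G (L v).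

(** This replaces the Cauchy-Schwarz inequality for [psi] and [phi]; unlike
    it, it requires no division by the norm of [phi], which may vanish. *)
Lemma ip_test_bound (p : R) (phi psi : E) :
  0 <= p -> p * ip phi phi <= ip psi phi -> p * ip psi phi <= ip psi psi.
Proof.
move=> p0 le; have := ip_ge0 (psi - p *: phi).
rewrite ipBl !ipBr !ipZl !ipZr (ip_sym phi psi).
have := ler_wpM2l p0 le; lra.
Qed.

(** The bound that [ip_test_bound] gives for a single [i] still involves the
    coefficients [ip (G (u i)) (u j)], about which nothing is known; the weights
    [lam k - lam i] are those for which they cancel in the sum over [i]. *)
Lemma commutator_inequality (N k : nat) (u : nat -> E) (lam : nat -> R)
    (L G : {linear E -> E}) :
  symmetric_op L -> symmetric_op G -> orthonormal N u -> N = \dim {:E} ->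
  (forall i, (i < N)%N -> L (u i) = lam i *: u i) ->
  (forall i j, (i <= j < N)%N -> lam i <= lam j) -> (k < N)%N ->
  \sum_(i < k) (lam k - lam i) ^+ 2 * ip (commutator L G (u i)) (G (u i)) <=
  \sum_(i < k) (lam k - lam i) *
    ip (commutator L G (u i)) (commutator L G (u i)).
Proof.
move=> Lsym Gsym on dimE eig lam_mono kN.
have onk := orthonormalW (ltnW kN) on.
pose a (i j : 'I_k) := ip (G (u i)) (u j).
pose p (i : 'I_k) := lam k - lam i.
pose C (i : 'I_k) := commutator L G (u i).
have eigk (i : 'I_k) : L (u i) = lam i *: u i.
  by apply: eig; apply: ltn_trans kN.
have aC (i j : 'I_k) : a i j = a j i by rewrite /a Gsym ip_sym.
(* The matrix of the commutator in an eigenbasis of [L]; note that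
   [p i - p j] is [lam j - lam i]. *)
have b_a (i j : 'I_k) : ip (C i) (u j) = (p i - p j) * a i j.
  rewrite /C /commutator ipBl Lsym !eigk linearZ /= ipZl ipZr /a /p; ring.
have term (i : 'I_k) :
    p i * (ip (C i) (G (u i)) - \sum_(j < k) (p i - p j) * a i j ^+ 2) <=
    ip (C i) (C i) - \sum_(j < k) ((p i - p j) * a i j) ^+ 2.
  pose phi := residual u k (G (u i)); pose psi := residual u k (C i).
  have phi_orth j : (j < k)%N -> ip phi (u j) = 0 := residual_orth onk _ j.
  have <- : ip psi phi =
      ip (C i) (G (u i)) - \sum_(j < k) (p i - p j) * a i j ^+ 2.
    rewrite (ip_residual onk); congr (_ - _); apply: eq_bigr => j _.
    by rewrite b_a -/(a i j); ring.
  have <- : ip psi psi =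
      ip (C i) (C i) - \sum_(j < k) ((p i - p j) * a i j) ^+ 2.
    rewrite (ip_residual onk); congr (_ - _); apply: eq_bigr => j _.
    by rewrite b_a expr2.
  apply: ip_test_bound; first by rewrite subr_ge0 lam_mono // kN ltnW.
  have -> : ip psi phi = ip (L phi) phi - lam i * ip phi phi.
    rewrite (ip_sym psi) (ip_orth_residual phi_orth) /C /commutator ipBr.
    rewrite eigk linearZ /= ipZr -Lsym -(ip_orth_residual phi_orth) -/phi.
    congr (_ - _); rewrite [RHS]ip_orth_residual // => j jk.
    by rewrite Lsym eig ?(ltn_trans jk) // ipZr phi_orth ?mulr0.
  rewrite mulrBl lerD2r.
  apply: (rayleigh_ge N k u lam) => // j /andP[kj jN].
  by apply: lam_mono; rewrite kj.
(* Multiplying [term i] by [p i] leaves the coefficients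
   [p i * (p i - p j) ^+ 2 - p i ^+ 2 * (p i - p j)] of [a i j ^+ 2], which
   simplify to this antisymmetric expression. *)
have cancel : \sum_i \sum_j p i * p j * (p j - p i) * a i j ^+ 2 = 0.
  by apply: sum_antisym => i j; rewrite (aC j i); ring.
rewrite -subr_ge0 -[leRHS]subr0 -[X in _ - X]cancel -!sumrB.
apply: sumr_ge0 => i _.
have pi : 0 <= p i by rewrite subr_ge0 lam_mono // kN ltnW.
rewrite -/(p i) -/(C i).
have -> : \sum_j p i * p j * (p j - p i) * a i j ^+ 2 =
   p i * (\sum_(j < k) ((p i - p j) * a i j) ^+ 2) -
   p i ^+ 2 * (\sum_(j < k) (p i - p j) * a i j ^+ 2).
  by rewrite !mulr_sumr -sumrB; apply: eq_bigr => j _; ring.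
have := ler_wpM2l pi (term i); lra.
Qed.

End InnerProduct.

(** * Sums over a finite subset of the lattice *)

Lemma stepN (n : nat) (p : 'I_n * bool) : step (p.1, ~~ p.2) = - step p.
Proof. by rewrite /step signrN scaleNr. Qed.

Lemma step_coord (n : nat) (p : 'I_n * bool) (a : 'I_n) :
  step p 0 a = if p.1 == a then (-1) ^+ p.2 else 0.
Proof.
by rewrite !mxE eqxx /= eq_sym; case: eqVneq => _; rewrite ?mulr1 ?mulr0.
Qed.

Lemma sum_steps (R : nmodType) (n : nat) (F : 'I_n * bool -> R) :
  \sum_p F p = \sum_a (F (a, false) + F (a, true)).
Proof.
transitivity (\sum_a \sum_b F (a, b)).
  by rewrite pair_bigA; apply: eq_bigr => -[].
by apply: eq_bigr => a _; rewrite big_bool addrC.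
Qed.

Section Lattice.

Context {R : realType} {n : nat} {Omega : {fset 'rV[int]_n}}.

Lemma zero_ext_val (f : Omega -> R) (x : Omega) : zero_ext f (val x) = f x.
Proof. by rewrite /zero_ext valK. Qed.

Lemma zero_ext_sum (f : Omega -> R) (z : 'rV[int]_n) :
  zero_ext f z = \sum_(y : Omega) (val y == z)%:R * f y.
Proof.
rewrite /zero_ext; case: insubP => [x _ <-|zO] /=.
  rewrite (bigD1 x) //= eqxx mul1r big1 ?addr0 // => y yx.
  by rewrite (inj_eq val_inj) (negPf yx) mul0r.
rewrite big1 // => y _; case: eqP => [yz|_]; last by rewrite mul0r.
by move: zO; rewrite -yz (valP y).
Qed.

(** Summation by parts: both sides are the sum of [f x * g y] over the pairs of
    points of [Omega] with [y - x = s]. *)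
Lemma sum_shift (f g : Omega -> R) (s : 'rV[int]_n) :
  \sum_x f x * zero_ext g (val x + s) = \sum_x zero_ext f (val x - s) * g x.
Proof.
under eq_bigr do rewrite zero_ext_sum mulr_sumr.
under [RHS]eq_bigr do rewrite zero_ext_sum mulr_suml.
rewrite exchange_big; apply: eq_bigr => y _; apply: eq_bigr => x _.
by rewrite -subr_eq eq_sym; case: eqP => _; rewrite ?mul1r // !mul0r mulr0.
Qed.

(** A translation can only lose mass, through the points leaving [Omega]. *)
Lemma sum_shift_sqr_le (f : Omega -> R) (s : 'rV[int]_n) :
  \sum_(x : Omega) zero_ext f (val x + s) ^+ 2 <= \sum_x f x ^+ 2.
Proof.
have sqrE z : zero_ext f z ^+ 2 = zero_ext (fun x => f x ^+ 2) z.
  by rewrite /zero_ext; case: insub => //=; rewrite expr0n.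
under eq_bigr => x _ do rewrite sqrE -[zero_ext _ _]mul1r.
rewrite (sum_shift (fun=> 1)); apply: ler_sum => x _.
rewrite -[leRHS]mul1r ler_wpM2r ?sqr_ge0 //.
by rewrite /zero_ext; case: insub => /=.
Qed.

Definition weighted_ip (rho : Omega -> R) (f g : {ffun Omega -> R^o}) : R :=
  \sum_x f x * g x * rho x.

Lemma weighted_ipP (rho : Omega -> R) :
  (forall x, 0 < rho x) -> inner_product (weighted_ip rho).
Proof.
move=> rho_gt0; split=> [a u v w|u v|u u0].
- rewrite mulr_sumr -big_split; apply: eq_bigr => x _.
  by rewrite !ffunE -[a *: u x]/(a * u x) /=; ring.
- by apply: eq_bigr => x _; rewrite (mulrC (u x)).
have sq x : 0 <= u x * u x * rho x.
  by rewrite mulr_ge0 ?(ltW (rho_gt0 x)) // -expr2 sqr_ge0.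
rewrite lt_neqAle sumr_ge0 // andbT eq_sym; apply: contra u0.
rewrite psumr_eq0 // => /allP u0; apply/eqP/ffunP => x; rewrite ffunE.
have := u0 x (mem_index_enum x); rewrite /= !mulf_eq0 orbb.
by rewrite (gt_eqF (rho_gt0 x)) orbF => /eqP.
Qed.

(** The bilinear form of the adjacency matrix of the graph induced on [Omega]. *)
Definition hopping (f g : Omega -> R) : R :=
  \sum_(x : Omega) f x * \sum_p zero_ext g (val x + step p).

Lemma hoppingE f g :
  hopping f g = \sum_p \sum_x f x * zero_ext g (val x + step p).
Proof. by rewrite exchange_big; apply: eq_bigr => x _; rewrite mulr_sumr. Qed.

Lemma hopping_sym f g : hopping f g = hopping g f.
Proof.
have flipK : involutive (fun p : 'I_n * bool => (p.1, ~~ p.2)).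
  by case=> a b /=; rewrite negbK.
rewrite !hoppingE (reindex_inj (inv_inj flipK)); apply: eq_bigr => p _ /=.
rewrite stepN sum_shift; apply: eq_bigr => x _.
by rewrite opprK mulrC.
Qed.

(** Every edge has two orientations, which contribute equally; [step (a, false)]
    is the positive unit vector in direction [a]. *)
Lemma hopping_diag f : hopping f f =
  2 * \sum_(a < n) \sum_x f x * zero_ext f (val x + step (a, false)).
Proof.
rewrite hoppingE sum_steps mulr_sumr; apply: eq_bigr => a _.
rewrite (stepN _ (a, false)) [X in _ + X]sum_shift [X in _ + X](eq_bigr
  (fun x => f x * zero_ext f (val x + step (a, false)))); first by ring.
by move=> x _; rewrite opprK mulrC.
Qed.

Definition coord_mul (a : 'I_n) (f : {ffun Omega -> R^o}) :
  {ffun Omega -> R^o} := [ffun x : Omega => (val x 0 a)%:~R * f x].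

Lemma coord_mul_is_linear (a : 'I_n) : linear (coord_mul a).
Proof.
move=> c f g; apply/ffunP => x; rewrite !ffunE.
by rewrite -[c *: f x]/(c * f x) -[c *: (_ * _)]/(c * (_ * _)); ring.
Qed.

HB.instance Definition _ (a : 'I_n) :=
  GRing.isLinear.Build R {ffun Omega -> R^o} {ffun Omega -> R^o} _
    (coord_mul a) (coord_mul_is_linear a).

Lemma zero_ext_coord_mul a f z :
  zero_ext (coord_mul a f) z = (z 0 a)%:~R * zero_ext f z.
Proof.
rewrite /zero_ext; case: insubP => [x _ <-|_] /=; first by rewrite ffunE.
by rewrite mulr0.
Qed.

Lemma coord_mul_sym rho a :
  symmetric_op (weighted_ip rho) (coord_mul a).
Proof. by move=> f g; apply: eq_bigr => x _; rewrite !ffunE; ring. Qed.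

(** * The commutator with a coordinate *)

Variables V rho : Omega -> R.
Hypothesis n_gt0 : (0 < n)%N.
Hypothesis rho_gt0 : forall x, 0 < rho x.

Lemma laplacian_hopping (f : Omega -> R) (x : Omega) :
  laplacian (zero_ext f) (val x) =
    (2 * n)%:R^-1 * \sum_p zero_ext f (val x + step p) - f x.
Proof.
rewrite laplacianE sumrB mulrBr zero_ext_val sumr_const card_prod card_ord.
rewrite card_bool [(n * 2)%N]mulnC -[f x *+ _]mulr_natl mulKf //.
by rewrite pnatr_eq0 muln_eq0 -lt0n.
Qed.

(** The weight [rho] of the inner product cancels the division by [rho]. *)
Lemma schrodinger_form (f g : {ffun Omega -> R^o}) :
  weighted_ip rho (schrodinger V rho f) g =
    \sum_x (1 + V x) * (f x * g x) - (2 * n)%:R^-1 * hopping g f.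
Proof.
rewrite mulr_sumr -sumrB; apply: eq_bigr => x _.
rewrite ffunE mulrAC divfK ?gt_eqF // laplacian_hopping; ring.
Qed.

Lemma schrodinger_sym :
  symmetric_op (weighted_ip rho) (schrodinger V rho).
Proof.
move=> f g; rewrite (ip_sym _ (weighted_ipP _ rho_gt0) f) !schrodinger_form.
rewrite hopping_sym; congr (_ - _); apply: eq_bigr => x _.
by rewrite (mulrC (f x)).
Qed.

(** Multiplication by a function commutes with everything in the operator except
    the sum over the neighbours [x + step p], where the coordinate [a] differs
    from that of [x] by [step p 0 a], nonzero only in the two steps along [a]. *)
Lemma commutatorE (a : 'I_n) (f : {ffun Omega -> R^o}) (x : Omega) :
  commutator (schrodinger V rho) (coord_mul a) f x =
    (2 * n)%:R^-1 * (zero_ext f (val x - step (a, false))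
                     - zero_ext f (val x + step (a, false))) / rho x.
Proof.
have key : \sum_p zero_ext (coord_mul a f) (val x + step p) =
   (val x 0 a)%:~R * (\sum_p zero_ext f (val x + step p)) +
   (zero_ext f (val x + step (a, false)) - zero_ext f (val x - step (a, false))).
  transitivity (\sum_p ((val x 0 a)%:~R * zero_ext f (val x + step p) +
     (step p 0 a)%:~R * zero_ext f (val x + step p))).
    apply: eq_bigr => p _.
    by rewrite zero_ext_coord_mul !mxE rmorphD mulrDl.
  rewrite big_split -mulr_sumr [X in _ + X = _]sum_steps; congr (_ + _).
  rewrite (bigD1 a) //= big1 => [|b ba].
    by rewrite !step_coord eqxx -(stepN _ (a, false)) /=; ring.
  by rewrite !step_coord (negPf ba) /= !mul0r addr0.
rewrite /commutator !ffunE /= !laplacian_hopping key !ffunE; ring.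
Qed.

(** Summation by parts turns the backward term of the central difference into
    the forward one, with the coordinate taken at [x + e] instead of [x]; since
    these differ by one, the coordinate drops out. *)
Lemma commutator_coord_form (a : 'I_n) (f : {ffun Omega -> R^o}) :
  weighted_ip rho (commutator (schrodinger V rho) (coord_mul a) f)
    (coord_mul a f) =
  (2 * n)%:R^-1 * \sum_x f x * zero_ext f (val x + step (a, false)).
Proof.
set e := step (a, false).
have shift : \sum_x coord_mul a f x * zero_ext f (val x - e) =
    \sum_x coord_mul a f x * zero_ext f (val x + e) +
    \sum_x f x * zero_ext f (val x + e).
  rewrite sum_shift -big_split; apply: eq_bigr => x _.
  rewrite opprK zero_ext_coord_mul ffunE mxE rmorphD /e step_coord eqxx /=; ring.
have -> : \sum_x f x * zero_ext f (val x + e) =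
    \sum_x coord_mul a f x * zero_ext f (val x - e) -
    \sum_x coord_mul a f x * zero_ext f (val x + e).
  by rewrite shift addrAC subrr add0r.
rewrite -sumrB mulr_sumr; apply: eq_bigr => x _.
by rewrite commutatorE -/e mulrAC divfK ?gt_eqF //; ring.
Qed.

(** * Estimates by the energy *)

Hypothesis V_ge0 : forall x, 0 <= V x.

Lemma deg_gt0 : 0 < (2 * n)%:R :> R.
Proof. by rewrite ltr0n muln_gt0. Qed.

Lemma sum_sqr_le_form (f : {ffun Omega -> R^o}) :
  \sum_x f x ^+ 2 - (2 * n)%:R^-1 * hopping f f <=
    weighted_ip rho (schrodinger V rho f) f.
Proof.
rewrite schrodinger_form lerD2r; apply: ler_sum => x _.
by rewrite -expr2 mulrDl mul1r lerDl mulr_ge0 ?sqr_ge0.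
Qed.

(** The left side counts an edge inside [Omega] twice and an edge leaving it
    once, whereas the Dirichlet energy, multiplied by the degree [2 * n], counts
    both once.  Expanding the squares reduces the inequality to
    [sum_shift_sqr_le]. *)
Lemma dirichlet_energy_le (f : {ffun Omega -> R^o}) :
  \sum_(x : Omega) \sum_p (zero_ext f (val x + step p) - f x) ^+ 2 <=
    2 * (2 * n)%:R * weighted_ip rho (schrodinger V rho f) f.
Proof.
apply: le_trans (_ : 2 * (2 * n)%:R * (\sum_x f x ^+ 2 -
    (2 * n)%:R^-1 * hopping f f) <= _); last first.
  by rewrite ler_wpM2l ?sum_sqr_le_form // mulr_ge0 ?ltW ?deg_gt0.
rewrite mulrBr mulrA mulfK ?gt_eqF ?deg_gt0 // hoppingE.
have -> : 2 * (2 * n)%:R * \sum_x f x ^+ 2 =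
    \sum_(p : 'I_n * bool) 2 * \sum_x f x ^+ 2.
  rewrite sumr_const card_prod card_ord card_bool -[RHS]mulr_natl mulrA.
  by rewrite (mulrC 2) [in RHS]mulnC.
rewrite exchange_big [X in _ - X]mulr_sumr -sumrB; apply: ler_sum => p _.
have := sum_shift_sqr_le f (step p).
have -> : \sum_(x : Omega) (zero_ext f (val x + step p) - f x) ^+ 2 =
    \sum_(x : Omega) zero_ext f (val x + step p) ^+ 2 + \sum_x f x ^+ 2 -
    2 * \sum_x f x * zero_ext f (val x + step p).
  by rewrite mulr_sumr -big_split -sumrB; apply: eq_bigr => x _ /=; ring.
lra.
Qed.

(** The central difference between [x + e] and [x - e] passes through [x]: its
    square is at most twice the sum of the squares of the two one-step
    differences, and summing over the directions gives the energy around
    [x]. *)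
Lemma commutator_norm_le (rho_min : R) (f : {ffun Omega -> R^o}) :
  0 < rho_min -> (forall x, rho_min <= rho x) ->
  \sum_(a < n) weighted_ip rho
      (commutator (schrodinger V rho) (coord_mul a) f)
      (commutator (schrodinger V rho) (coord_mul a) f) <=
    2 / (n%:R * rho_min) * weighted_ip rho (schrodinger V rho f) f.
Proof.
move=> rmin_gt0 rmin_le; set W := weighted_ip _ _ f; set d : R := (2 * n)%:R.
have d_gt0 : 0 < d := deg_gt0.
have -> : 2 / (n%:R * rho_min) * W = 2 * d^-1 ^+ 2 / rho_min * (2 * d * W).
  by rewrite /d natrM; field; rewrite gt_eqF //= gt_eqF // ltr0n.
apply: (@le_trans _ _ (2 * d^-1 ^+ 2 / rho_min *
   \sum_(x : Omega) \sum_p (zero_ext f (val x + step p) - f x) ^+ 2)).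
  rewrite exchange_big mulr_sumr; apply: ler_sum => x _.
  rewrite sum_steps mulr_sumr; apply: ler_sum => a _.
  rewrite commutatorE -/d (stepN _ (a, false)).
  set A := zero_ext f _; set B := zero_ext f _; set c := f x; set r := rho x.
  have r_gt0 : 0 < r := rho_gt0 x.
  have -> : d^-1 * (A - B) / r * (d^-1 * (A - B) / r) * r =
      d^-1 ^+ 2 * ((A - B) ^+ 2 / r).
    by clearbody d r; field; rewrite !gt_eqF.
  rewrite [leRHS](_ : _ = d^-1 ^+ 2 *
    (2 * ((B - c) ^+ 2 + (A - c) ^+ 2) / rho_min)); last by ring.
  rewrite ler_wpM2l ?sqr_ge0 //.
  rewrite ler_pM ?sqr_ge0 ?invr_ge0 ?(ltW r_gt0) //; last first.
    by rewrite lef_pV2 // rmin_le.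
  (* 2 (B - c)^2 + 2 (A - c)^2 - (A - B)^2 = (A + B - 2 c)^2 *)
  by have := sqr_ge0 (A + B - 2 * c); lra.
by rewrite ler_wpM2l ?dirichlet_energy_le // !mulr_ge0 ?sqr_ge0 ?invr_ge0 ?ltW.
Qed.

(** The sum is half of [hopping f f / (2 * n)], by [commutator_coord_form], and
    this quotient is the unweighted mass of [f] plus its potential energy minus
    its total energy.  Since the mass weighted by [rho] is 1, the unweighted one
    is at least [rho_max^-1]. *)
Lemma commutator_form_ge (rho_max : R) (f : {ffun Omega -> R^o}) :
  0 < rho_max -> (forall x, rho x <= rho_max) -> weighted_ip rho f f = 1 ->
  (rho_max^-1 - weighted_ip rho (schrodinger V rho f) f) / 2 <=
  \sum_(a < n) weighted_ip rho
      (commutator (schrodinger V rho) (coord_mul a) f) (coord_mul a f).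
Proof.
move=> rmax_gt0 rmax_ge f1.
under [leRHS]eq_bigr => a _ do rewrite commutator_coord_form.
rewrite -mulr_sumr.
have mass : rho_max^-1 <= \sum_x f x ^+ 2.
  rewrite -[leLHS]mulr1 mulrC ler_pdivrMr // -f1 mulr_suml.
  by apply: ler_sum => x _; rewrite -expr2 ler_wpM2l ?sqr_ge0.
have := sum_sqr_le_form f; rewrite hopping_diag; lra.
Qed.

End Lattice.

(** * Yang's inequality on the lattice *)

Lemma dim_ffunR (R : realType) (T : finType) : \dim {: {ffun T -> R^o}} = #|T|.
Proof. by rewrite dimvf /dim /= muln1. Qed.

(* The list [lam] is indexed from 0: [lam`_i] is the eigenvalue number i + 1. *)
Theorem theorem1p1 (R : realType) (n : nat) (n_ge1 : (1 <= n)%N)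
  (Omega : {fset 'rV[int]_n})
  (V rho : Omega -> R)
  (V_ge0 : forall x, 0 <= V x) (rho_gt0 : forall x, 0 < rho x)
  (lam : #|` Omega|.-tuple R) (lam_eigen : eigenvalues V rho lam)
  (rho_min rho_max : R)
  (rho_minP : is_min rho rho_min) (rho_maxP : is_max rho rho_max)
  (k : nat) (k_ge1 : (1 <= k)%N) (k_le : (k <= #|` Omega| - 1)%N) :
  \sum_(i < k) (lam`_k - lam`_i) *
     (lam`_k * (rho_min / rho_max - rho_min * lam`_i)
      - lam`_i * (rho_min / rho_max - rho_min * lam`_i + 4 / n%:R)) <= 0.
Proof.
case: lam_eigen => lam_sorted lam_mult.
case: rho_minP => -[xmin rho_xmin] rmin_le.
case: rho_maxP => -[xmax rho_xmax] rmax_ge.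
have rmin_gt0 : 0 < rho_min by rewrite -rho_xmin.
have rmax_gt0 : 0 < rho_max by rewrite -rho_xmax.
have ipP := weighted_ipP _ rho_gt0.
have Lsym := schrodinger_sym V _ n_ge1 rho_gt0.
have [u] := orthonormal_eigenvectors _ ipP (schrodinger V rho) lam Lsym
  (fun mu => eq_leq (lam_mult mu)).
rewrite size_tuple => on eig.
have kN : (k < #|` Omega|)%N.
  by move: k_ge1 k_le; case: #|` Omega| => [|N]; rewrite ?subn1 //; case: (k).
have lam_mono i j : (i <= j < #|` Omega|)%N -> lam`_i <= lam`_j.
  case/andP=> ij jN; apply: (sorted_leq_nth le_trans le_refl) => //;
  by rewrite inE size_tuple // (leq_ltn_trans ij).
have dimN : #|` Omega| = \dim {: {ffun Omega -> R^o}}.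
  by rewrite dim_ffunR cardfE.
have yang (a : 'I_n) := commutator_inequality _ ipP _ k u (nth 0 lam) _
  (coord_mul a) Lsym (coord_mul_sym rho a) on dimN eig lam_mono kN.
have {yang} := ler_sum (P := xpredT) (index_enum 'I_n) (fun a _ => yang a).
rewrite exchange_big [leRHS]exchange_big /= => yang.
have form1 (i : 'I_k) : weighted_ip rho (u i) (u i) = 1.
  by rewrite on ?eqxx // (ltn_trans _ kN).
have formL (i : 'I_k) : weighted_ip rho (schrodinger V rho (u i)) (u i) = lam`_i.
  by rewrite eig ?(ltn_trans _ kN) // (ipZl _ ipP) form1 mulr1.
have gap_ge0 (i : 'I_k) : 0 <= lam`_k - lam`_i.
  by rewrite subr_ge0 lam_mono // kN ltnW.
(* The claim is this inequality multiplied by [2 * rho_min]. *)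
suff : \sum_(i < k) (lam`_k - lam`_i) ^+ 2 * ((rho_max^-1 - lam`_i) / 2) <=
    \sum_(i < k) (lam`_k - lam`_i) * (2 / (n%:R * rho_min) * lam`_i).
  rewrite -subr_le0 -sumrB => le.
  have : 2 * rho_min *
     (\sum_(i < k) ((lam`_k - lam`_i) ^+ 2 * ((rho_max^-1 - lam`_i) / 2) -
       (lam`_k - lam`_i) * (2 / (n%:R * rho_min) * lam`_i))) <= 0.
    by rewrite mulr_ge0_le0 // mulr_ge0 ?ltW.
  rewrite mulr_sumr; congr (_ <= _); apply: eq_bigr => i _.
  by field; rewrite !gt_eqF // ltr0n.
apply: le_trans (le_trans yang _); apply: ler_sum => i _.
  rewrite -mulr_sumr ler_wpM2l ?sqr_ge0 // -formL.
  exact: commutator_form_ge.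
rewrite -mulr_sumr ler_wpM2l // -formL.
exact: commutator_norm_le.
Qed.
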